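(* Let $\kappa>0$, $\beta>0$, $\alpha\neq 0$ and $c$ be real numbers with $c\neq \frac{36\alpha^2}{169\beta}$ and $c\neq-\frac{1836\,\alpha^2}{845\,\beta}$. Put $$g_2=\frac{169\beta c-22\alpha^2}{2^3\cdot 3\cdot 7\cdot 13^2\,\beta^2},\qquad g_3=\frac{\alpha\,(3\cdot 169\,\beta c-2^7\alpha^2)}{2^5\cdot 3^3\cdot 5\cdot 13^3\,\beta^3},$$ and assume $g_2^3-27g_3^2\neq 0$. Then $$u(x,t)=\frac{35}{3\cdot 13^2\,\kappa\beta}\Big[\alpha-2^2\cdot 3\cdot 13\,\beta\,\wp(x-ct;g_2,g_3)\Big]^2$$ is a solution of the Kawahara equation $$u_t+\kappa u u_x+\alpha u_{xxx}-\beta u_{xxxxx}=0$$ at all real $(x,t)$ for which $x-ct$ is not a pole of $\wp(\cdot\,;g_2,g_3)$. Moreover, as a function of $\xi=x-ct$ it satisfies the integrated traveling wave equation $$-cu+\tfrac{\kappa}{2}u^2+\alpha u_{\xi\xi}-\beta u_{\xi\xi\xi\xi}=\mathcal A$$ with the nonzero constant $$\mathcal A=\frac{(36\alpha^2-169\beta c)(2^2\cdot 3^3\cdot 17\,\alpha^2+5\cdot 169\,\beta c)}{2^3\cdot 7\cdot 13^4\,\kappa\beta^2}.$$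
   Context: $\wp(\xi;g_2,g_3)$ denotes the Weierstrass elliptic function with real invariants $g_2,g_3$ (modular discriminant $g_2^3-27g_3^2\ne0$), i.e. the meromorphic function with a double pole at $0$ satisfying $\wp_\xi^2=4\wp^3-g_2\wp-g_3$. A nonzero boundary condition for a traveling wave $u(\xi)$, $\xi=x-ct$, means that the integration constant $\mathcal A$, obtained by integrating once in $\xi$ the ODE $-cu_\xi+\kappa uu_\xi+\alpha u_{\xi\xi\xi}-\beta u_{\xi\xi\xi\xi\xi}=0$, is nonzero. *)

(* Defs.v *)
From Stdlib Require Import Reals.
From Coquelicot Require Import Coquelicot.

Open Scope R_scope.

(** ** Meromorphic functions on the complex plane *)

Definition analytic_at (f : C -> C) (a : C) : Prop :=
  exists (r : R) (s : nat -> C), 0 < r /\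
    forall z : C, Cmod (z - a)%C < r ->
      @is_pseries C_AbsRing C_NormedModule s (z - a)%C (f z).

(** [f] is [h(z) / (z - a)^m] on a punctured disc around [a], with [h] analytic
    and nonzero at [a]. The value [f a] plays no role. *)
Definition pole_of_order (f : C -> C) (a : C) (m : nat) : Prop :=
  (0 < m)%nat /\
  exists h : C -> C, analytic_at h a /\ h a <> RtoC 0 /\
    exists r : R, 0 < r /\
      forall z : C, 0 < Cmod (z - a)%C < r -> f z = (h z / (z - a) ^ m)%C.

Definition is_pole (f : C -> C) (a : C) : Prop :=
  exists m : nat, pole_of_order f a m.

(** A meromorphic function is represented by a total function whose values at
    the poles are arbitrary; removable singularities are excluded. *)
Definition meromorphic (f : C -> C) : Prop :=
  forall a : C, analytic_at f a \/ is_pole f a.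

(** ** The Weierstrass elliptic function with real invariants

    These conditions determine [P] uniquely away from its poles. *)
Definition is_weierstrass_p (g2 g3 : R) (P : C -> C) : Prop :=
  meromorphic P /\
  pole_of_order P (RtoC 0) 2 /\
  forall z : C, ~ is_pole P z ->
    exists d : C, @is_derive C_AbsRing C_NormedModule P z d /\
      (d ^ 2 = 4 * P z ^ 3 - RtoC g2 * P z - RtoC g3)%C.

(** ** The Kawahara equation *)

(** [Derive_n] is total, so the existence of all the derivatives, in a
    neighbourhood of the point, has to be required separately. *)
Definition differentiable_n (n : nat) (f : R -> R) (x : R) : Prop :=
  locally x (fun y : R => forall k : nat, (k <= n)%nat -> ex_derive_n f k y).

Definition solves_kawahara_at (kappa alpha beta : R) (u : R -> R -> R)
    (x t : R) : Prop :=
  ex_derive (fun s => u x s) t /\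
  differentiable_n 5 (fun y => u y t) x /\
  Derive (fun s => u x s) t
    + kappa * u x t * Derive (fun y => u y t) x
    + alpha * Derive_n (fun y => u y t) 3 x
    - beta * Derive_n (fun y => u y t) 5 x = 0.

(** The traveling wave ODE integrated once, with integration constant [A]. *)
Definition solves_integrated_ode_at (kappa alpha beta c A : R) (U : R -> R)
    (xi : R) : Prop :=
  differentiable_n 4 U xi /\
  - c * U xi + kappa / 2 * U xi ^ 2
    + alpha * Derive_n U 2 xi - beta * Derive_n U 4 xi = A.

(** Since [g2] and [g3] are real, the Weierstrass function is real on the real
    line, and taking its real part only changes the type of its values. *)
Definition wave_profile (kappa alpha beta : R) (P : C -> C) (xi : R) : R :=
  35 / (3 * 13 ^ 2 * kappa * beta)
    * (alpha - 2 ^ 2 * 3 * 13 * beta * Re (P (RtoC xi))) ^ 2.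

(* Main.v *)
Require Import Defs.
From Stdlib Require Import Reals Lra Lia Wf_nat Classical ClassicalEpsilon.
From Coquelicot Require Import Coquelicot.

Open Scope R_scope.

(** Restricted to the real line, the real and imaginary parts of [P] are real meromorphic, so an
    identity that holds on one interval holds on the whole line.  Near the pole [0] the
    first-order equation for [z ^ 2 * P z] determines its solution, which forces [Im P = 0] there,
    hence everywhere.  Similarly [Re P] is nowhere locally constant, so the first-order equation
    may be differentiated to [p'' = 6 p ^ 2 - g2 / 2].  All derivatives of the wave profile are then
    polynomials in [p] and [p'], and both wave equations become polynomial identities. *)

(** * Real-analytic and real-meromorphic germs, isolated zeros and the identity theorem on the
    line *)

Definition real_analytic (f : R -> R) (a : R) : Prop :=
  exists s : nat -> R, Rbar_lt 0 (CV_radius s) /\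
    locally a (fun y => f y = PSeries s (y - a)).

(** The exponent [m] need not be an exact pole order: [m = 0] covers regular points, and [f] may
    vanish at [a]. This suits real and imaginary parts, whose leading coefficient can be zero even
    where the complex one is not. *)
Definition real_meromorphic (F : R -> R) (a : R) : Prop :=
  exists (m : nat) (f : R -> R), real_analytic f a /\
    locally' a (fun y => F y * (y - a) ^ m = f y).

Lemma locally_of_Rabs (a r : R) (Q : R -> Prop) :
  0 < r -> (forall y, Rabs (y - a) < r -> Q y) -> locally a Q.
Proof. intros hr H. exists (mkposreal r hr). intros y hy. apply H, hy. Qed.

Lemma locally_Rabs_ex (a : R) (Q : R -> Prop) :
  locally a Q -> exists r, 0 < r /\ forall y, Rabs (y - a) < r -> Q y.
Proof. intros [r H]. exists r. split; [apply cond_pos|]. intros y hy. apply H, hy. Qed.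

Lemma locally_locally' (a : R) (Q : R -> Prop) : locally a Q -> locally' a Q.
Proof. unfold locally', within. apply filter_imp. auto. Qed.

Lemma locally'_ex (a : R) (Q : R -> Prop) : locally' a Q -> exists y, Q y.
Proof.
  intros H. destruct (locally_Rabs_ex _ _ H) as [r [hr K]].
  exists (a + r / 2). apply K; [|lra].
  rewrite Rabs_pos_eq; lra.
Qed.

Lemma locally_shift (a : R) (Q : R -> Prop) :
  locally 0 Q -> locally a (fun y => Q (y - a)).
Proof.
  intros H. destruct (locally_Rabs_ex _ _ H) as [r [hr K]].
  apply (locally_of_Rabs a r); [exact hr|]. intros y hy. apply K.
  now replace (y - a - 0) with (y - a) by ring.
Qed.

Lemma locally_CV_radius (s : nat -> R) :
  Rbar_lt 0 (CV_radius s) -> locally 0 (fun y => Rbar_lt (Rabs y) (CV_radius s)).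
Proof.
  intros H. destruct (CV_radius s) as [r| |]; simpl in H |- *; try easy.
  - apply (locally_of_Rabs 0 r); [exact H|]. intros y hy. now rewrite Rminus_0_r in hy.
  - apply filter_forall. intros; exact I.
Qed.

Lemma real_analytic_derivatives (f : R -> R) (a : R) :
  real_analytic f a -> locally a (fun y => forall n, ex_derive_n f n y).
Proof.
  intros [s [hs H]].
  apply locally_locally in H.
  generalize (filter_and _ _ H (locally_shift a _ (locally_CV_radius s hs))).
  apply filter_imp. intros y [Hy Hr] n.
  apply ex_derive_n_ext_loc with (fun y => PSeries s (y + - a)).
  { revert Hy. apply filter_imp. intros t Ht. now rewrite Ht. }
  apply ex_derive_n_comp_trans. now apply ex_derive_n_PSeries.
Qed.

Lemma real_analytic_continuous (f : R -> R) (a : R) :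
  real_analytic f a -> continuous f a.
Proof.
  intros H. apply (ex_derive_continuous (V := R_NormedModule)).
  exact (locally_singleton _ _ (real_analytic_derivatives f a H) 1%nat).
Qed.

(** Clearing a denominator [(y - a) ^ m] from [F - C] produces exactly this function, so that
    subtracting a constant preserves [real_meromorphic]. *)
Lemma real_analytic_minus_monomial (f : R -> R) (a C : R) (m : nat) :
  real_analytic f a -> real_analytic (fun y => f y - C * (y - a) ^ m) a.
Proof.
  intros [s [hs H]].
  set (e := PS_incr_n (fun k => match k with O => C | _ => 0 end) m).
  assert (He : forall x, is_pseries e x (C * x ^ m)).
  { intros x. unfold e.
    replace (C * x ^ m) with (scal (pow_n x m) C)
      by (rewrite pow_n_pow; apply Rmult_comm).
    apply (is_pseries_incr_n (V := R_NormedModule)).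
    apply (filterlim_ext (fun _ => C)); [|apply filterlim_const].
    induction x0 as [|n IH].
    - rewrite sum_O. simpl. unfold scal, one; simpl. unfold mult; simpl. ring.
    - rewrite sum_Sn, <- IH. unfold scal, plus; simpl. unfold mult; simpl. ring. }
  assert (Hd : locally 0 (fun x => is_pseries (PS_minus s e) x (PSeries s x - C * x ^ m))).
  { generalize (locally_CV_radius s hs). apply filter_imp. intros x hx.
    apply (is_pseries_minus (V := R_NormedModule)); [|apply He].
    apply PSeries_correct, CV_radius_inside, hx. }
  exists (PS_minus s e). split.
  - destruct (locally_Rabs_ex _ _ Hd) as [r [hr K]].
    (* A zero radius would prevent the terms at [r / 2] from tending to zero, whereas the series
       converges there. *)
    destruct (Rbar_lt_le_dec 0 (CV_radius (PS_minus s e))) as [h|h]; [exact h|exfalso].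
    apply (CV_disk_outside (PS_minus s e) (r / 2)).
    + apply Rbar_le_lt_trans with 0; [exact h|]. simpl. rewrite Rabs_pos_eq; lra.
    + apply ex_series_lim_0.
      assert (K' := K (r / 2)).
      exists (PSeries s (r / 2) - C * (r / 2) ^ m).
      apply is_pseries_R, K'. rewrite Rabs_pos_eq; lra.
  - generalize (filter_and _ _ H (locally_shift a _ Hd)).
    apply filter_imp. intros y [-> Hy]. symmetry. now apply is_pseries_unique.
Qed.

(** If [s n] is the first nonzero coefficient, then [f y = (y - a) ^ n * g (y - a)] with [g]
    continuous and [g 0 = s n], so neither factor vanishes close to [a] except at [a] itself. *)
Lemma real_analytic_isolated_zeros (f : R -> R) (a : R) :
  real_analytic f a ->
  locally a (fun y => f y = 0) \/ locally' a (fun y => f y <> 0).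
Proof.
  intros [s [hs H]].
  destruct (classic (exists n, s n <> 0)) as [hn|hn].
  - right.
    destruct (dec_inh_nat_subset_has_unique_least_element (fun n => s n <> 0))
      as [n [[hn1 hn2] _]]; [intros; apply classic|exact hn|].
    assert (hlow : forall k, (k < n)%nat -> s k = 0).
    { intros k hk. apply NNPP. intros h. specialize (hn2 k h). lia. }
    assert (hrad : CV_radius (PS_decr_n s n) = CV_radius s).
    { clear. induction n as [|n IH]; [now apply CV_radius_ext|].
      rewrite <- IH, <- (CV_radius_decr_1 (PS_decr_n s n)). apply CV_radius_ext.
      intros k. unfold PS_decr_1, PS_decr_n. f_equal. lia. }
    assert (hc : continuous (PSeries (PS_decr_n s n)) 0).
    { apply continuity_pt_filterlim, PSeries_continuity. now rewrite Rabs_R0, hrad. }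
    assert (h0 : PSeries (PS_decr_n s n) 0 <> 0).
    { rewrite PSeries_0. unfold PS_decr_n. now rewrite Nat.add_0_r. }
    assert (hl : locally 0 (fun x => PSeries (PS_decr_n s n) x <> 0)).
    { apply (hc (fun u => u <> 0)). exact (open_neq 0 _ h0). }
    generalize (filter_and _ _ H (locally_shift a _ hl)).
    unfold locally', within. apply filter_imp. intros y [-> hy] hya.
    rewrite (PSeries_decr_n_aux _ _ _ hlow).
    apply Rmult_integral_contrapositive_currified; [|exact hy].
    apply pow_nonzero. lra.
  - left. revert H. apply filter_imp. intros y ->.
    rewrite <- (PSeries_const_0 (y - a)). apply PSeries_ext.
    intros n. apply NNPP. intros h. apply hn. now exists n.
Qed.

Lemma real_meromorphic_isolated_zeros (F : R -> R) (a : R) :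
  real_meromorphic F a ->
  locally' a (fun y => F y = 0) \/ locally' a (fun y => F y <> 0).
Proof.
  intros [m [f [hf H]]].
  destruct (real_analytic_isolated_zeros f a hf) as [h|h]; [left|right];
    unfold locally', within in *.
  - generalize (filter_and _ _ H h). apply filter_imp. intros y [h1 h2] hy.
    specialize (h1 hy). rewrite h2 in h1.
    destruct (Rmult_integral _ _ h1) as [h3|h3]; [exact h3|].
    exfalso. revert h3. apply pow_nonzero. lra.
  - generalize (filter_and _ _ H h). apply filter_imp. intros y [h1 h2] hy h3.
    apply (h2 hy). rewrite <- (h1 hy), h3. ring.
Qed.

Lemma locally'_locally (a : R) (Q : R -> Prop) :
  locally' a Q -> locally a (fun y => y <> a -> locally y Q).
Proof.
  intros H. destruct (locally_Rabs_ex _ _ H) as [r [hr K]].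
  apply (locally_of_Rabs a r); [exact hr|]. intros y hy hne.
  assert (h1 : open (fun t => Rabs (t - a) < r /\ t <> a)).
  { apply open_and; [|apply open_neq].
    intros t ht. apply (locally_of_Rabs t (r - Rabs (t - a))); [lra|].
    intros v hv. replace (v - a) with ((v - t) + (t - a)) by ring.
    eapply Rle_lt_trans; [apply Rabs_triang|lra]. }
  generalize (h1 y (conj hy hne)). apply filter_imp. intros t [ht1 ht2]. now apply K.
Qed.

(** Connectedness of the line in analytic form: a locally constant function has zero derivative
    everywhere. *)
Lemma locally_constant_eq (chi : R -> R) :
  (forall a, locally a (fun y => chi y = chi a)) -> forall x y, chi x = chi y.
Proof.
  intros H.
  assert (hlt : forall x y, x < y -> chi x = chi y).
  { intros x y hxy. apply (eq_is_derive (V := R_NormedModule)); [|exact hxy].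
    intros t _. apply (is_derive_ext_loc (fun _ => chi t)).
    - generalize (H t). apply filter_imp. intros u ->. reflexivity.
    - apply (is_derive_const (V := R_NormedModule)). }
  intros x y. destruct (Rtotal_order x y) as [h|[->|h]]; [|reflexivity|symmetry]; auto.
Qed.

(** By isolated zeros, each point has a neighbourhood on which the indicator [chi] of the set [Z] is
    constant: if [F] vanishes on a punctured neighbourhood of [x], all nearby points lie in [Z], and
    otherwise none do. Connectedness then makes [chi] constant. *)
Lemma real_meromorphic_identity (F : R -> R) (a b : R) :
  (forall x, real_meromorphic F x) ->
  locally' a (fun y => F y = 0) -> locally' b (fun y => F y = 0).
Proof.
  intros hF ha.
  set (Z := fun x => locally' x (fun y => F y = 0)).
  set (chi := fun x => if excluded_middle_informative (Z x) then 1 else 0).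
  assert (excl : forall x, locally' x (fun y => F y <> 0) -> ~ Z x).
  { intros x h1 h2.
    destruct (locally'_ex x _ (filter_and _ _ h1 h2)) as [y [h3 h4]]. exact (h3 h4). }
  assert (hchi : forall x, locally x (fun y => chi y = chi x)).
  { intros x. destruct (real_meromorphic_isolated_zeros F x (hF x)) as [h|h].
    - generalize (locally'_locally x _ h). apply filter_imp. intros y hy.
      unfold chi. destruct (excluded_middle_informative (Z x)) as [_|n]; [|now destruct n].
      destruct (excluded_middle_informative (Z y)) as [_|n]; [reflexivity|].
      destruct n. destruct (Req_dec y x) as [->|hne]; [exact h|].
      exact (locally_locally' y _ (hy hne)).
    - generalize (locally'_locally x _ h). apply filter_imp. intros y hy.
      unfold chi. destruct (excluded_middle_informative (Z x)) as [n|_]; [now destruct (excl x h)|].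
      destruct (excluded_middle_informative (Z y)) as [n|_]; [|reflexivity].
      destruct (Req_dec y x) as [->|hne]; [now destruct (excl x h)|].
      destruct (excl y); [|exact n]. exact (locally_locally' y _ (hy hne)). }
  generalize (locally_constant_eq chi hchi a b). unfold chi.
  destruct (excluded_middle_informative (Z a)) as [_|n]; [|now destruct n].
  destruct (excluded_middle_informative (Z b)) as [h|_]; [intros _; exact h|lra].
Qed.

(** * Restriction of complex functions to the real line through their real and imaginary parts *)

(** Collects what [Re] and [Im] share, so that series, poles and derivatives are transferred once
    for both. *)
Record real_linear_contraction (L : C -> R) : Prop := {
  rlc_plus : forall z w, L (z + w)%C = L z + L w;
  rlc_scal : forall t z, L (RtoC t * z)%C = t * L z;
  rlc_bound : forall z, Rabs (L z) <= Cmod z;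
  rlc_cont : forall z : C_UniformSpace, filterlim L (locally z) (locally (L z)) }.

Lemma Re_real_linear : real_linear_contraction Re.
Proof.
  split.
  - reflexivity.
  - intros t z. simpl. unfold Re. ring.
  - intros z. eapply Rle_trans; [|apply Rmax_Cmod]. apply Rmax_l.
  - intros z Q [e H]. exists e. intros y [h _]. apply H, h.
Qed.

Lemma Im_real_linear : real_linear_contraction Im.
Proof.
  split.
  - reflexivity.
  - intros t z. simpl. unfold Im. ring.
  - intros z. eapply Rle_trans; [|apply Rmax_Cmod]. apply Rmax_r.
  - intros z Q [e H]. exists e. intros y [_ h]. apply H, h.
Qed.

(** At a real argument the powers of [x] are real scalars, so [L] passes through each partial sum,
    and by continuity through the limit. *)
Lemma rlc_pseries (L : C -> R) (s : nat -> C) (x : R) (l : C) :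
  real_linear_contraction L ->
  @is_pseries C_AbsRing C_NormedModule s (RtoC x) l ->
  is_pseries (fun n => L (s n)) x (L l).
Proof.
  intros [hp hs _ hc] H.
  apply (filterlim_ext (fun n => L (sum_n (fun k => scal (pow_n (RtoC x : C_AbsRing) k) (s k)) n))).
  - assert (hpow : forall n, pow_n (RtoC x : C_AbsRing) n = RtoC (pow_n x n)).
    { induction n as [|n IH]; [reflexivity|].
      simpl. rewrite IH. symmetry. apply RtoC_mult. }
    assert (hterm : forall n, L (scal (pow_n (RtoC x : C_AbsRing) n) (s n))
                              = scal (pow_n x n) (L (s n))).
    { intros n. rewrite hpow. apply hs. }
    induction x0 as [|n IH].
    + rewrite !sum_O. apply hterm.
    + rewrite !sum_Sn. rewrite <- IH, <- hterm. apply hp.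
  - eapply filterlim_comp; [exact H|apply hc].
Qed.

Lemma analytic_at_real (L : C -> R) (f : C -> C) (a : R) :
  real_linear_contraction L -> analytic_at f (RtoC a) ->
  real_analytic (fun y => L (f (RtoC y))) a.
Proof.
  intros hL [r [s [hr H]]].
  assert (K : forall y, Rabs (y - a) < r ->
    is_pseries (fun n => L (s n)) (y - a) (L (f (RtoC y)))).
  { intros y hy. apply rlc_pseries; [exact hL|].
    rewrite RtoC_minus. apply H. now rewrite <- RtoC_minus, Cmod_R. }
  exists (fun n => L (s n)). split.
  - destruct (Rbar_lt_le_dec 0 (CV_radius (fun n => L (s n)))) as [h|h]; [exact h|exfalso].
    apply (CV_disk_outside (fun n => L (s n)) (r / 2)).
    + apply Rbar_le_lt_trans with 0; [exact h|]. simpl. rewrite Rabs_pos_eq; lra.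
    + apply ex_series_lim_0.
      assert (K' := K (a + r / 2)).
      eexists. apply is_pseries_R. replace (a + r / 2 - a) with (r / 2) in K' by ring.
      apply K'. rewrite Rabs_pos_eq; lra.
  - apply (locally_of_Rabs a r); [exact hr|]. intros y hy.
    symmetry. now apply is_pseries_unique, K.
Qed.

Lemma pole_of_order_real (f : C -> C) (a : R) (m : nat) :
  pole_of_order f (RtoC a) m ->
  exists h : C -> C, analytic_at h (RtoC a) /\ h (RtoC a) <> RtoC 0 /\
    locally' a (fun y => (RtoC ((y - a) ^ m) * f (RtoC y))%C = h (RtoC y)).
Proof.
  intros [_ [h [ha [h0 [r [hr H]]]]]]. exists h. split; [exact ha|split; [exact h0|]].
  apply (locally_of_Rabs a r); [exact hr|]. intros y hy hne.
  rewrite H; rewrite <- RtoC_minus.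
  - rewrite RtoC_pow. field. rewrite <- RtoC_pow. intros h1. apply RtoC_inj in h1.
    revert h1. apply pow_nonzero. lra.
  - rewrite Cmod_R. split; [|exact hy]. apply Rabs_pos_lt. lra.
Qed.

Lemma meromorphic_real (L : C -> R) (f : C -> C) :
  real_linear_contraction L -> meromorphic f ->
  forall a, real_meromorphic (fun y => L (f (RtoC y))) a.
Proof.
  intros hL hf a. destruct (hf (RtoC a)) as [h|[m hm]].
  - exists 0%nat, (fun y => L (f (RtoC y))). split; [now apply analytic_at_real|].
    apply locally_locally', filter_forall. intros y. simpl. ring.
  - destruct (pole_of_order_real f a m hm) as [h [ha [_ H]]].
    exists m, (fun y => L (h (RtoC y))). split; [now apply analytic_at_real|].
    unfold locally', within in *. revert H.
    apply filter_imp. intros y hy hne.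
    rewrite <- (hy hne), (rlc_scal L hL). ring.
Qed.

Lemma real_meromorphic_minus_const (F : R -> R) (a C : R) :
  real_meromorphic F a -> real_meromorphic (fun y => F y - C) a.
Proof.
  intros [m [f [hf H]]]. exists m, (fun y => f y - C * (y - a) ^ m).
  split; [now apply real_analytic_minus_monomial|].
  unfold locally', within in *. revert H. apply filter_imp. intros y hy hne.
  rewrite <- (hy hne). ring.
Qed.

(** At a pole, [(y - a) ^ m * f y] agrees with [h y] off [a]. If [f] were continuous along the line,
    letting [y] tend to [a] would give [h a = 0], because [m > 0]. This is how points are shown to
    lie in the domain of the Weierstrass equation. *)
Lemma continuous_not_pole (f : C -> C) (a : R) :
  continuous (fun y => Re (f (RtoC y))) a ->
  continuous (fun y => Im (f (RtoC y))) a ->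
  ~ is_pole f (RtoC a).
Proof.
  intros hre him [m hm].
  destruct (pole_of_order_real f a m hm) as [h [ha [h0 H]]].
  assert (hmpos : (0 < m)%nat) by (destruct hm; assumption).
  assert (aux : forall L, real_linear_contraction L ->
    continuous (fun y => L (f (RtoC y))) a -> L (h (RtoC a)) = 0).
  { intros L hL hc.
    assert (h1 : continuous (fun y => (y - a) ^ m * L (f (RtoC y)) - L (h (RtoC y))) a).
    { apply (continuous_minus (V := R_NormedModule)).
      - apply (continuous_mult (K := R_AbsRing)); [|exact hc].
        apply (ex_derive_continuous (V := R_NormedModule)). auto_derive. exact I.
      - apply real_analytic_continuous. now apply analytic_at_real. }
    set (g := fun y => (y - a) ^ m * L (f (RtoC y)) - L (h (RtoC y))) in h1.
    assert (g0 : g a = - L (h (RtoC a))).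
    { unfold g. rewrite Rminus_diag, pow_i; [ring|exact hmpos]. }
    destruct (Req_dec (g a) 0) as [h2|h2]; [lra|exfalso].
    assert (h3 := h1 (fun u => u <> 0) (open_neq 0 _ h2)).
    destruct (locally'_ex a _ (filter_and _ _ (locally_locally' _ _ h3) H)) as [y [h4 h5]].
    apply h4. unfold g. rewrite <- h5, (rlc_scal L hL). apply Rminus_diag. }
  apply h0. apply injective_projections.
  - exact (aux Re Re_real_linear hre).
  - exact (aux Im Im_real_linear him).
Qed.

Lemma analytic_not_pole_near (f : C -> C) (a : R) :
  analytic_at f (RtoC a) -> locally a (fun y => ~ is_pole f (RtoC y)).
Proof.
  intros ha.
  assert (h1 := real_analytic_derivatives _ _ (analytic_at_real Re f a Re_real_linear ha)).
  assert (h2 := real_analytic_derivatives _ _ (analytic_at_real Im f a Im_real_linear ha)).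
  generalize (filter_and _ _ h1 h2). apply filter_imp. intros y [k1 k2].
  apply continuous_not_pole; apply (ex_derive_continuous (V := R_NormedModule)).
  - exact (k1 1%nat).
  - exact (k2 1%nat).
Qed.

(** The increment [y - x] is real, so [L] of the complex remainder is the real remainder, and
    [rlc_bound] keeps it as small. *)
Lemma is_derive_real (L : C -> R) (f : C -> C) (x : R) (d : C) :
  real_linear_contraction L ->
  @is_derive C_AbsRing C_NormedModule f (RtoC x) d ->
  is_derive (fun y => L (f (RtoC y))) x (L d).
Proof.
  intros hL [_ H]. split; [apply is_linear_scal_l|].
  intros x0 hx0 eps.
  apply (is_filter_lim_locally_unique (V := R_NormedModule)) in hx0. subst x0.
  assert (H1 := H (RtoC x) (fun Q hQ => hQ) eps).
  destruct H1 as [e H1]. exists e. intros y hy.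
  assert (hb : ball (RtoC x : AbsRing_UniformSpace C_AbsRing) e (RtoC y)).
  { change (Cmod (RtoC y - RtoC x)%C < e). rewrite <- RtoC_minus, Cmod_R. exact hy. }
  specialize (H1 (RtoC y) hb).
  change (Cmod ((f (RtoC y) - f (RtoC x)) - (RtoC y - RtoC x) * d)%C
    <= eps * Cmod (RtoC y - RtoC x)%C) in H1.
  change (Rabs ((L (f (RtoC y)) - L (f (RtoC x))) - (y - x) * L d)
    <= eps * Rabs (y - x)).
  rewrite <- RtoC_minus, Cmod_R in H1.
  replace (L (f (RtoC y)) - L (f (RtoC x)) - (y - x) * L d)
    with (L (f (RtoC y) - f (RtoC x) - RtoC (y - x) * d)%C).
  - eapply Rle_trans; [apply (rlc_bound L hL)|exact H1].
  - replace (f (RtoC y) - f (RtoC x) - RtoC (y - x) * d)%C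
      with (f (RtoC y) + (RtoC (-1) * f (RtoC x) + RtoC (-1) * (RtoC (y - x) * d)))%C by ring.
    rewrite !(rlc_plus L hL), !(rlc_scal L hL). ring.
Qed.

Lemma continuous_zero_punctured (g : R -> R) (a : R) :
  continuous g a -> locally' a (fun y => g y = 0) -> g a = 0.
Proof.
  intros hg H. apply NNPP. intros h.
  destruct (locally'_ex a _ (filter_and _ _
    (locally_locally' _ _ (hg (fun u => u <> 0) (open_neq 0 _ h))) H)) as [y [h1 h2]].
  exact (h1 h2).
Qed.

Lemma ex_derive_continuous_R (f : R -> R) (x : R) : ex_derive f x -> continuous f x.
Proof. apply (ex_derive_continuous (V := R_NormedModule)). Qed.

(** * The Weierstrass function on the real line: reality, non-constancy and the second-order
    equation *)

Lemma weierstrass_components (g2 g3 : R) (P : C -> C) (x : R) :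
  is_weierstrass_p g2 g3 P -> ~ is_pole P (RtoC x) ->
  exists p' q' : R,
    is_derive (fun y => Re (P (RtoC y))) x p' /\
    is_derive (fun y => Im (P (RtoC y))) x q' /\
    let p := Re (P (RtoC x)) in let q := Im (P (RtoC x)) in
    p' ^ 2 - q' ^ 2 = 4 * (p ^ 3 - 3 * p * q ^ 2) - g2 * p - g3 /\
    2 * p' * q' = 4 * (3 * p ^ 2 * q - q ^ 3) - g2 * q.
Proof.
  intros [_ [_ hode]] hx. destruct (hode _ hx) as [d [hd he]].
  exists (Re d), (Im d).
  split; [now apply is_derive_real; [apply Re_real_linear|]|].
  split; [now apply is_derive_real; [apply Im_real_linear|]|].
  simpl. destruct (P (RtoC x)) as [p q], d as [p' q']. unfold Re, Im. simpl.
  apply pair_equal_spec in he. simpl in he. destruct he as [h1 h2].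
  split; [ring_simplify in h1; ring_simplify; lra|ring_simplify in h2; ring_simplify; lra].
Qed.

(** With [h = a + i b = y ^ 2 P], one has [P' = (y h' - 2 h) / y ^ 3]. Multiplying the equation by
    [y ^ 6] removes all denominators, and its value at [y = 0] is [4 h(0) ^ 2 = 4 h(0) ^ 3], which
    fixes the leading coefficient. *)
Lemma weierstrass_near_0 (g2 g3 : R) (P : C -> C) :
  is_weierstrass_p g2 g3 P ->
  exists a b : R -> R, real_analytic a 0 /\ real_analytic b 0 /\ a 0 = 1 /\ b 0 = 0 /\
    locally' 0 (fun y => Re (P (RtoC y)) = a y / y ^ 2 /\ Im (P (RtoC y)) = b y / y ^ 2 /\
      2 * (y * Derive a y - 2 * a y) * (y * Derive b y - 2 * b y) =
        4 * (3 * a y ^ 2 * b y - b y ^ 3) - g2 * y ^ 4 * b y).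
Proof.
  intros hP. assert (hpole := proj1 (proj2 hP)).
  destruct (pole_of_order_real P 0 2 hpole) as [h [ha [h0 H]]].
  assert (hA := analytic_at_real Re h 0 Re_real_linear ha).
  assert (hB := analytic_at_real Im h 0 Im_real_linear ha).
  set (a := fun y => Re (h (RtoC y))) in hA.
  set (b := fun y => Im (h (RtoC y))) in hB.
  assert (dA := real_analytic_derivatives a 0 hA).
  assert (dB := real_analytic_derivatives b 0 hB).
  assert (Hval : locally' 0 (fun y => Re (P (RtoC y)) = a y / y ^ 2
                                  /\ Im (P (RtoC y)) = b y / y ^ 2)).
  { unfold locally', within in *. revert H. apply filter_imp. intros y hy hne.
    specialize (hy hne). rewrite Rminus_0_r in hy. unfold a, b.
    rewrite <- hy, (rlc_scal Re Re_real_linear), (rlc_scal Im Im_real_linear).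
    split; field; exact hne. }
  assert (Hode : locally' 0 (fun y =>
    (y * Derive a y - 2 * a y) ^ 2 - (y * Derive b y - 2 * b y) ^ 2 =
      4 * (a y ^ 3 - 3 * a y * b y ^ 2) - g2 * y ^ 4 * a y - g3 * y ^ 6 /\
    2 * (y * Derive a y - 2 * a y) * (y * Derive b y - 2 * b y) =
      4 * (3 * a y ^ 2 * b y - b y ^ 3) - g2 * y ^ 4 * b y)).
  (* Differentiating the formulas for [P] at [y] needs them on a full neighbourhood of [y], not only
     at [y]. *)
  { assert (Hloc := locally'_locally 0 _ Hval).
    generalize (filter_and _ _ Hloc (filter_and _ _ dA dB)).
    unfold locally', within. apply filter_imp. intros y [hy [da db]] hne. specialize (hy hne).
    assert (da1 : ex_derive a y) by exact (da 1%nat).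
    assert (db1 : ex_derive b y) by exact (db 1%nat).
    assert (hquot : forall f, ex_derive f y -> is_derive (fun t => f t / t ^ 2) y
              ((y * Derive f y - 2 * f y) / y ^ 3)).
    { intros f hf. auto_derive; [split; [exact hf|split; [|exact I]]|].
      { apply Rmult_integral_contrapositive_currified; [exact hne|now rewrite Rmult_1_r]. }
      change (fun x : R => f x) with f. field. exact hne. }
    assert (eRe : locally y (fun t => a t / t ^ 2 = Re (P (RtoC t)))).
    { revert hy. apply filter_imp. intros t [h1 _]. now symmetry. }
    assert (eIm : locally y (fun t => b t / t ^ 2 = Im (P (RtoC t)))).
    { revert hy. apply filter_imp. intros t [_ h1]. now symmetry. }
    assert (dRe := is_derive_ext_loc _ _ _ _ eRe (hquot a da1)).
    assert (dIm := is_derive_ext_loc _ _ _ _ eIm (hquot b db1)).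
    assert (hnp : ~ is_pole P (RtoC y)).
    { apply continuous_not_pole; apply ex_derive_continuous_R; eexists; eassumption. }
    destruct (weierstrass_components g2 g3 P y hP hnp) as [p' [q' [hp' [hq' [e1 e2]]]]].
    assert (ep := eq_trans (eq_sym (is_derive_unique _ _ _ hp')) (is_derive_unique _ _ _ dRe)).
    assert (eq := eq_trans (eq_sym (is_derive_unique _ _ _ hq')) (is_derive_unique _ _ _ dIm)).
    destruct (locally_singleton _ _ hy) as [v1 v2].
    rewrite v1, v2, ep, eq in e1, e2.
    split.
    - transitivity ((((y * Derive a y - 2 * a y) / y ^ 3) ^ 2
        - ((y * Derive b y - 2 * b y) / y ^ 3) ^ 2) * y ^ 6); [field; exact hne|].
      rewrite e1. field. exact hne.
    - transitivity ((2 * ((y * Derive a y - 2 * a y) / y ^ 3)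
        * ((y * Derive b y - 2 * b y) / y ^ 3)) * y ^ 6); [field; exact hne|].
      rewrite e2. field. exact hne. }
  assert (da1 : ex_derive a 0) by exact (locally_singleton _ _ dA 1%nat).
  assert (db1 : ex_derive b 0) by exact (locally_singleton _ _ dB 1%nat).
  assert (da2 : ex_derive (Derive a) 0) by exact (locally_singleton _ _ dA 2%nat).
  assert (db2 : ex_derive (Derive b) 0) by exact (locally_singleton _ _ dB 2%nat).
  assert (l1 : (0 * Derive a 0 - 2 * a 0) ^ 2 - (0 * Derive b 0 - 2 * b 0) ^ 2 -
      (4 * (a 0 ^ 3 - 3 * a 0 * b 0 ^ 2) - g2 * 0 ^ 4 * a 0 - g3 * 0 ^ 6) = 0).
  { apply (continuous_zero_punctured (fun y =>
      (y * Derive a y - 2 * a y) ^ 2 - (y * Derive b y - 2 * b y) ^ 2 -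
      (4 * (a y ^ 3 - 3 * a y * b y ^ 2) - g2 * y ^ 4 * a y - g3 * y ^ 6))).
    - apply ex_derive_continuous_R. auto_derive. repeat split; assumption.
    - unfold locally', within in *. revert Hode. apply filter_imp.
      intros y hy hne. destruct (hy hne) as [-> _]. ring. }
  assert (l2 : 2 * (0 * Derive a 0 - 2 * a 0) * (0 * Derive b 0 - 2 * b 0) -
      (4 * (3 * a 0 ^ 2 * b 0 - b 0 ^ 3) - g2 * 0 ^ 4 * b 0) = 0).
  { apply (continuous_zero_punctured (fun y =>
      2 * (y * Derive a y - 2 * a y) * (y * Derive b y - 2 * b y) -
      (4 * (3 * a y ^ 2 * b y - b y ^ 3) - g2 * y ^ 4 * b y))).
    - apply ex_derive_continuous_R. auto_derive. repeat split; assumption.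
    - unfold locally', within in *. revert Hode. apply filter_imp.
      intros y hy hne. destruct (hy hne) as [_ ->]. ring. }
  assert (hnz : (a 0 ^ 2 + b 0 ^ 2) ^ 2 <> 0).
  { apply pow_nonzero. intros hz. apply h0.
    assert (a 0 = 0) by nra. assert (b 0 = 0) by nra.
    apply injective_projections; assumption. }
  (* With [h 0 = a 0 + i b 0], [l1] and [l2] say [h 0 ^ 2 * (h 0 - 1) = 0]. *)
  assert (ha1 : a 0 = 1).
  { apply Rminus_diag_uniq, (Rmult_eq_reg_l ((a 0 ^ 2 + b 0 ^ 2) ^ 2)); [|exact hnz].
    rewrite Rmult_0_r.
    (* The combination is the real part of [- 1 / 4] times the conjugate of [h 0 ^ 2] times the
       complex equation, which leaves [|h 0| ^ 4 * (a 0 - 1)]. *)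
    transitivity (- / 4 * ((a 0 ^ 2 - b 0 ^ 2) *
      ((0 * Derive a 0 - 2 * a 0) ^ 2 - (0 * Derive b 0 - 2 * b 0) ^ 2 -
      (4 * (a 0 ^ 3 - 3 * a 0 * b 0 ^ 2) - g2 * 0 ^ 4 * a 0 - g3 * 0 ^ 6)) +
      2 * a 0 * b 0 * (2 * (0 * Derive a 0 - 2 * a 0) * (0 * Derive b 0 - 2 * b 0) -
      (4 * (3 * a 0 ^ 2 * b 0 - b 0 ^ 3) - g2 * 0 ^ 4 * b 0)))); [field|].
    rewrite l1, l2. ring. }
  assert (hb0 : b 0 = 0).
  (* With [a 0 = 1], [l1] reduces to [8 * b 0 ^ 2 = 0]. *)
  { rewrite ha1 in *. clear - l2 l1. nra. }
  exists a, b. split; [exact hA|split; [exact hB|split; [exact ha1|split; [exact hb0|]]]].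
  unfold locally', within in *. generalize (filter_and _ _ Hval Hode).
  apply filter_imp. intros y [h1 h2] hne. destruct (h1 hne), (h2 hne). auto.
Qed.

(* The imaginary part of the differential equation for [h = a + i b = z ^ 2 P] reads
   [2 (y a' - 2 a) y b' = b (12 a ^ 2 - 4 b ^ 2 - g2 y ^ 4 + 4 (y a' - 2 a))], where
   [y a' - 2 a -> -2] and the last bracket tends to [4]: so [b ^ 2] decreases from [0]. *)
Lemma weierstrass_real_right_0 (g2 g3 : R) (P : C -> C) :
  is_weierstrass_p g2 g3 P ->
  exists delta, 0 < delta /\ forall x, 0 < x < delta -> Im (P (RtoC x)) = 0.
Proof.
  intros hP.
  destruct (weierstrass_near_0 g2 g3 P hP) as [a [b [hA [hB [ha1 [hb0 H]]]]]].
  assert (dA := real_analytic_derivatives a 0 hA).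
  assert (dB := real_analytic_derivatives b 0 hB).
  assert (da1 : ex_derive a 0) by exact (locally_singleton _ _ dA 1%nat).
  assert (db1 : ex_derive b 0) by exact (locally_singleton _ _ dB 1%nat).
  assert (da2 : ex_derive (Derive a) 0) by exact (locally_singleton _ _ dA 2%nat).
  set (k := fun y => y * Derive a y - 2 * a y).
  set (B := fun y => 4 * (3 * a y ^ 2 - b y ^ 2) - g2 * y ^ 4 + 4 * k y).
  assert (hk : locally 0 (fun y => k y < 0)).
  { assert (hc : continuous k 0).
    { apply ex_derive_continuous_R. unfold k. auto_derive. repeat split; assumption. }
    apply (hc (fun u => u < 0)), (open_lt 0). unfold k. rewrite ha1. lra. }
  assert (hBp : locally 0 (fun y => 0 < B y)).
  { assert (hc : continuous B 0).
    { apply ex_derive_continuous_R. unfold B, k. auto_derive. repeat split; assumption. }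
    apply (hc (fun u => 0 < u)), (open_gt 0). unfold B, k. rewrite ha1, hb0. lra. }
  unfold locally', within in H.
  destruct (locally_Rabs_ex 0 _ (filter_and _ _ H (filter_and _ _ hk (filter_and _ _ hBp dB))))
    as [r [hr K]].
  exists r. split; [exact hr|]. intros x hx.
  assert (hsmall : forall y, 0 <= y <= x -> Rabs (y - 0) < r).
  { intros y hy. rewrite Rminus_0_r, Rabs_pos_eq; lra. }
  assert (hd : forall y, 0 <= y <= x -> is_derive (fun t => b t ^ 2) y (2 * b y * Derive b y)).
  { intros y hy. destruct (K y (hsmall y hy)) as [_ [_ [_ h]]].
    assert (h1 : ex_derive b y) by exact (h 1%nat).
    auto_derive; [exact h1|]. change (fun x : R => b x) with b. ring. }
  destruct (MVT_gen (fun t => b t ^ 2) 0 x (fun y => 2 * b y * Derive b y)) as [c [hc e]].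
  - intros y hy. apply hd. rewrite Rmin_left, Rmax_right in hy; lra.
  - intros y hy. apply continuity_pt_filterlim, ex_derive_continuous_R.
    exists (2 * b y * Derive b y). apply hd. rewrite Rmin_left, Rmax_right in hy; lra.
  (* Since [b 0 = 0], the mean value theorem gives [b x ^ 2 = 2 * b c * b' c * x], so it suffices
     that [b c * b' c] is not positive. *)
  - rewrite Rmin_left, Rmax_right in hc by lra. rewrite hb0 in e.
    assert (hneg : b c * Derive b c <= 0).
    { destruct (Req_dec c 0) as [->|hc0]; [rewrite hb0; lra|].
      destruct (K c (hsmall c hc)) as [h1 [h2 [h3 _]]].
      destruct (h1 hc0) as [_ [_ h4]].
      (* Multiplying the equation by [b c] turns it into a sign statement: the right side is
         nonnegative and [2 * c * k c] is negative. *)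
      assert (h5 : (b c * Derive b c) * (2 * c * k c) = b c ^ 2 * B c).
      { fold (k c) in h4.
        transitivity (b c * (2 * k c * (c * Derive b c - 2 * b c)) + 4 * b c ^ 2 * k c); [ring|].
        rewrite h4. unfold B. ring. }
      assert (h6 : 2 * c * k c < 0) by nra.
      assert (h7 : 0 <= b c ^ 2 * B c) by (apply Rmult_le_pos; [apply pow2_ge_0|lra]).
      nra. }
    assert (hbx : b x = 0).
    { apply Rsqr_0_uniq, Rle_antisym; [|apply Rle_0_sqr].
      unfold Rsqr. assert (0 <= - (b c * Derive b c) * x) by (apply Rmult_le_pos; lra). lra. }
    destruct (K x (hsmall x ltac:(lra))) as [h1 _].
    destruct (h1 ltac:(lra)) as [_ [-> _]]. rewrite hbx. unfold Rdiv. ring.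
Qed.

(** Vanishing of [Im P] just to the right of [0] rules out the nonvanishing alternative for isolated
    zeros, so [Im P] vanishes on both sides. The identity theorem carries this to a punctured
    neighbourhood of [x], and continuity fills in [x]. *)
Lemma weierstrass_real (g2 g3 : R) (P : C -> C) :
  is_weierstrass_p g2 g3 P ->
  forall x, ~ is_pole P (RtoC x) -> Im (P (RtoC x)) = 0.
Proof.
  intros hP x hx.
  assert (hmer := meromorphic_real Im P Im_real_linear (proj1 hP)).
  assert (h0 : locally' 0 (fun y => Im (P (RtoC y)) = 0)).
  { destruct (real_meromorphic_isolated_zeros _ 0 (hmer 0)) as [h|h]; [exact h|exfalso].
    destruct (weierstrass_real_right_0 g2 g3 P hP) as [d [hd K]].
    destruct (locally_Rabs_ex 0 _ h) as [r [hr K']].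
    set (y := Rmin d r / 2).
    assert (hy : 0 < y < d /\ y < r).
    { unfold y. generalize (Rmin_l d r), (Rmin_r d r), (Rmin_glb_lt d r 0 hd hr). lra. }
    apply (K' y); [rewrite Rminus_0_r, Rabs_pos_eq; lra|lra|apply K; lra]. }
  destruct (proj1 hP (RtoC x)) as [ha|ha]; [|contradiction].
  apply (continuous_zero_punctured (fun y => Im (P (RtoC y)))).
  - apply real_analytic_continuous, analytic_at_real; [apply Im_real_linear|exact ha].
  - exact (real_meromorphic_identity _ 0 x hmer h0).
Qed.

(** The identity theorem would spread the constant to a punctured neighbourhood of [0], where
    [y ^ 2 * Re P] tends to [1] but [C * y ^ 2] tends to [0]. *)
Lemma weierstrass_not_constant (g2 g3 : R) (P : C -> C) (x C : R) :
  is_weierstrass_p g2 g3 P -> ~ locally x (fun y => Re (P (RtoC y)) = C).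
Proof.
  intros hP H.
  assert (hmer : forall a, real_meromorphic (fun y => Re (P (RtoC y)) - C) a).
  { intros a. apply real_meromorphic_minus_const, meromorphic_real;
      [apply Re_real_linear|exact (proj1 hP)]. }
  assert (h0 : locally' 0 (fun y => Re (P (RtoC y)) - C = 0)).
  { apply (real_meromorphic_identity _ x 0 hmer). apply locally_locally'.
    revert H. apply filter_imp. intros y ->. ring. }
  destruct (weierstrass_near_0 g2 g3 P hP) as [a [b [hA [_ [ha1 [_ K]]]]]].
  assert (hz : a 0 - C * 0 ^ 2 = 0).
  { apply (continuous_zero_punctured (fun y => a y - C * y ^ 2)).
    - apply (continuous_minus (V := R_NormedModule)); [now apply real_analytic_continuous|].
      apply ex_derive_continuous_R. auto_derive. exact I.
    - unfold locally', within in *. generalize (filter_and _ _ h0 K).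
      apply filter_imp. intros y [h1 h2] hne.
      specialize (h1 hne). destruct (h2 hne) as [h3 _]. rewrite h3 in h1.
      replace (a y - C * y ^ 2) with ((a y / y ^ 2 - C) * y ^ 2) by (field; exact hne).
      rewrite h1. ring. }
  lra.
Qed.

(* Differentiating the first-order equation gives [2 p' (p'' - 6 p ^ 2 + g2 / 2) = 0];
   were the second factor nonzero somewhere, [p] would be constant nearby. *)
Lemma weierstrass_system (g2 g3 : R) (P : C -> C) (x : R) :
  is_weierstrass_p g2 g3 P -> ~ is_pole P (RtoC x) ->
  exists q : R -> R, locally x (fun y =>
    is_derive (fun t => Re (P (RtoC t))) y (q y) /\
    is_derive q y (6 * Re (P (RtoC y)) ^ 2 - g2 / 2) /\
    q y ^ 2 = 4 * Re (P (RtoC y)) ^ 3 - g2 * Re (P (RtoC y)) - g3).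
Proof.
  intros hP hx.
  destruct (proj1 hP (RtoC x)) as [ha|ha]; [|contradiction].
  set (p := fun t => Re (P (RtoC t))).
  assert (hd := real_analytic_derivatives p x (analytic_at_real Re P x Re_real_linear ha)).
  assert (hsq : locally x (fun y => Derive p y ^ 2 = 4 * p y ^ 3 - g2 * p y - g3)).
  { assert (hnp := analytic_not_pole_near P x ha).
    generalize (locally_locally _ _ hnp). apply filter_imp. intros y hy.
    destruct (weierstrass_components g2 g3 P y hP (locally_singleton _ _ hy))
      as [p' [q' [h1 [h2 [h3 _]]]]].
    rewrite (weierstrass_real g2 g3 P hP y (locally_singleton _ _ hy)) in h3.
    (* [Im P] vanishes on a whole neighbourhood of [y], which contains no poles, so its derivative
       vanishes too. *)
    assert (hq : q' = 0).
    { rewrite <- (is_derive_unique _ _ _ h2), <- (Derive_const 0 y).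
      apply Derive_ext_loc. revert hy. apply filter_imp.
      intros t ht. exact (weierstrass_real g2 g3 P hP t ht). }
    replace (Derive p y) with p' by (symmetry; exact (is_derive_unique _ _ _ h1)).
    rewrite hq in h3. unfold p. lra. }
  exists (Derive p).
  generalize (filter_and _ _ (locally_locally _ _ hsq) (locally_locally _ _ hd)).
  apply filter_imp. intros y [hs hdy].
  assert (hy := locally_singleton _ _ hdy).
  split; [apply Derive_correct; exact (hy 1%nat)|split; [|exact (locally_singleton _ _ hs)]].
  replace (6 * Re (P y) ^ 2 - g2 / 2) with (Derive (Derive p) y);
    [apply Derive_correct; exact (hy 2%nat)|].
  apply Rminus_diag_uniq, NNPP. intros hne.
  set (D := fun t => Derive (Derive p) t - (6 * p t ^ 2 - g2 / 2)).
  assert (hDc : continuous D y).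
  { apply ex_derive_continuous_R.
    assert (d1 : ex_derive p y) by exact (hy 1%nat).
    assert (d3 : ex_derive (Derive (Derive p)) y) by exact (hy 3%nat).
    unfold D. auto_derive. repeat split; assumption. }
  assert (hD : locally y (fun t => D t <> 0)) by exact (hDc (fun u => u <> 0) (open_neq 0 _ hne)).
  assert (h0 : locally y (fun t => Derive p t = 0)).
  { generalize (filter_and _ _ hD (filter_and _ _ (locally_locally _ _ hs) hdy)).
    apply filter_imp. intros t [k1 [k2 k3]].
    assert (d1 : ex_derive p t) by exact (k3 1%nat).
    assert (d2 : ex_derive (Derive p) t) by exact (k3 2%nat).
    assert (e1 : Derive (fun u => Derive p u ^ 2) t = 2 * Derive p t * Derive (Derive p) t).
    { apply is_derive_unique. auto_derive; [exact d2|].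
      change (fun u : R => Derive p u) with (Derive p). ring. }
    assert (e2 : Derive (fun u => 4 * p u ^ 3 - g2 * p u - g3) t
                 = (12 * p t ^ 2 - g2) * Derive p t).
    { apply is_derive_unique. auto_derive; [repeat split; exact d1|].
      change (fun u : R => p u) with p. ring. }
    assert (e := eq_trans (eq_sym e1) (eq_trans (Derive_ext_loc _ _ _ k2) e2)).
    apply (Rmult_eq_reg_r (D t)); [|exact k1]. unfold D. lra. }
  apply (weierstrass_not_constant g2 g3 P y (p y) hP).
  (* A zero derivative on an interval around [y] makes [p] constant there, by the mean value
     theorem. *)
  destruct (locally_Rabs_ex y _ (filter_and _ _ h0 hdy)) as [r [hr K]].
  apply (locally_of_Rabs y r); [exact hr|]. intros t ht.
  assert (hin : forall u, Rmin y t <= u <= Rmax y t -> Rabs (u - y) < r).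
  { intros u hu. apply Rabs_def2 in ht. apply Rabs_def1;
      revert hu; unfold Rmin, Rmax; destruct (Rle_dec y t); lra. }
  destruct (MVT_gen p y t (fun _ => 0)) as [c [_ e]].
  - intros u hu. destruct (K u (hin u ltac:(lra))) as [k1 k2].
    rewrite <- k1. apply Derive_correct. exact (k2 1%nat).
  - intros u hu. destruct (K u (hin u hu)) as [_ k2].
    apply continuity_pt_filterlim, ex_derive_continuous_R. exact (k2 1%nat).
  - change (p t = p y). lra.
Qed.

(** * Closed forms for the derivatives of the wave profile *)

(** The induction identifies [Derive_n] with [F k] on a neighbourhood, since the next derivative
    depends on more than the value at one point. *)
Lemma derivative_chain (F : nat -> R -> R) (n : nat) (x : R) :
  locally x (fun y => forall k, (k < n)%nat -> is_derive (F k) y (F (S k) y)) ->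
  locally x (fun y => forall k, (k <= n)%nat ->
    ex_derive_n (F 0%nat) k y /\ Derive_n (F 0%nat) k y = F k y).
Proof.
  intros H. apply locally_locally in H. revert H. apply filter_imp. intros y H.
  assert (K : forall k, (k <= n)%nat -> locally y (fun t => Derive_n (F 0%nat) k t = F k t)).
  { induction k as [|k IH]; intros hk.
    - apply filter_forall. reflexivity.
    - assert (IH' := IH ltac:(lia)).
      generalize (filter_and _ _ (locally_locally _ _ IH') H).
      apply filter_imp. intros t [h1 h2]. simpl.
      rewrite (Derive_ext_loc _ _ _ h1). apply is_derive_unique, h2. lia. }
  intros k hk. split; [|exact (locally_singleton _ _ (K k hk))].
  destruct k as [|k]; [exact I|]. simpl.
  apply (ex_derive_ext_loc (F k)).
  - assert (K' := K k ltac:(lia)). revert K'. apply filter_imp. auto.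
  - exists (F (S k) y). apply (locally_singleton _ _ H). lia.
Qed.

(* [wave_derivative k] is the [k]-th derivative of [L * (alpha - b * p) ^ 2] when
   [p' = q], [q' = 6 p ^ 2 - g2 / 2] and [q ^ 2 = 4 p ^ 3 - g2 p - g3]. *)
Definition wave_derivative (L alpha b g2 g3 : R) (k : nat) (p q : R) : R :=
  match k with
  | 0%nat => L * (alpha - b * p) ^ 2
  | 1%nat => L * (- 2 * b * (alpha - b * p)) * q
  | 2%nat => L * (b ^ 2 * (20 * p ^ 3 - 3 * g2 * p - 2 * g3) - b * alpha * (12 * p ^ 2 - g2))
  | 3%nat => L * (b ^ 2 * (60 * p ^ 2 - 3 * g2) - 24 * b * alpha * p) * q
  | 4%nat => L * (b ^ 2 * (840 * p ^ 4 - 168 * g2 * p ^ 2 - 120 * g3 * p + 3 / 2 * g2 ^ 2)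
                  - b * alpha * (240 * p ^ 3 - 36 * g2 * p - 24 * g3))
  | _ => L * (b ^ 2 * (3360 * p ^ 3 - 336 * g2 * p - 120 * g3)
              - b * alpha * (720 * p ^ 2 - 36 * g2)) * q
  end.

Lemma is_derive_wave_derivative (L alpha b g2 g3 : R) (p q : R -> R) (y : R) (k : nat) :
  is_derive p y (q y) -> is_derive q y (6 * p y ^ 2 - g2 / 2) ->
  q y ^ 2 = 4 * p y ^ 3 - g2 * p y - g3 -> (k < 5)%nat ->
  is_derive (fun t => wave_derivative L alpha b g2 g3 k (p t) (q t)) y
    (wave_derivative L alpha b g2 g3 (S k) (p y) (q y)).
Proof.
  intros hp hq hsq hk.
  assert (ep : ex_derive p y) by (eexists; exact hp).
  assert (eq : ex_derive q y) by (eexists; exact hq).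
  assert (dp : Derive (fun t : R => p t) y = q y) by exact (is_derive_unique _ _ _ hp).
  assert (dq : Derive (fun t : R => q t) y = 6 * p y ^ 2 - g2 / 2)
    by exact (is_derive_unique _ _ _ hq).
  destruct k as [|[|[|[|[|k]]]]]; [..|lia]; unfold wave_derivative;
    auto_derive; try (repeat split; assumption); rewrite ?dp, ?dq; try field.
  (* The goals left are those for [k = 1] and [k = 3], where the product rule creates [q ^ 2]; it is
     isolated here so that the first-order equation can replace it by a cubic in [p]. *)
  - transitivity (L * (2 * b ^ 2 * q y ^ 2
      - 2 * b * (alpha - b * p y) * (6 * p y ^ 2 - g2 / 2))); [field|].
    rewrite hsq. field.
  - transitivity (L * ((120 * b ^ 2 * p y - 24 * b * alpha) * q y ^ 2
      + (b ^ 2 * (60 * p y ^ 2 - 3 * g2) - 24 * b * alpha * p y)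
        * (6 * p y ^ 2 - g2 / 2))); [field|].
    rewrite hsq. field.
Qed.

Lemma wave_chain (g2 g3 L alpha b : R) (P : C -> C) (xi : R) :
  is_weierstrass_p g2 g3 P -> ~ is_pole P (RtoC xi) ->
  exists q : R -> R, locally xi (fun y => forall k, (k < 5)%nat ->
    is_derive (fun t => wave_derivative L alpha b g2 g3 k (Re (P (RtoC t))) (q t)) y
      (wave_derivative L alpha b g2 g3 (S k) (Re (P (RtoC y))) (q y))).
Proof.
  intros hP hxi. destruct (weierstrass_system g2 g3 P xi hP hxi) as [q H].
  exists q. revert H. apply filter_imp. intros y [h1 [h2 h3]] k hk.
  now apply (is_derive_wave_derivative L alpha b g2 g3 (fun t => Re (P (RtoC t))) q).
Qed.

(** * The Kawahara equation, its integrated form and the integration constant *)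

Theorem mainTheorem1 (kappa alpha beta c g2 g3 A : R) (P : C -> C)
    (hkappa : 0 < kappa) (hbeta : 0 < beta) (halpha : alpha <> 0)
    (hc1 : c <> 36 * alpha ^ 2 / (169 * beta))
    (hc2 : c <> - (1836 * alpha ^ 2 / (845 * beta)))
    (hg2 : g2 = (169 * beta * c - 22 * alpha ^ 2)
                / (2 ^ 3 * 3 * 7 * 13 ^ 2 * beta ^ 2))
    (hg3 : g3 = alpha * (3 * 169 * beta * c - 2 ^ 7 * alpha ^ 2)
                / (2 ^ 5 * 3 ^ 3 * 5 * 13 ^ 3 * beta ^ 3))
    (hdisc : g2 ^ 3 - 27 * g3 ^ 2 <> 0)
    (hA : A = (36 * alpha ^ 2 - 169 * beta * c)
              * (2 ^ 2 * 3 ^ 3 * 17 * alpha ^ 2 + 5 * 169 * beta * c)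
              / (2 ^ 3 * 7 * 13 ^ 4 * kappa * beta ^ 2))
    (hP : is_weierstrass_p g2 g3 P) :
  (forall xi : R, ~ is_pole P (RtoC xi) -> Im (P (RtoC xi)) = 0) /\
  (forall x t : R, ~ is_pole P (RtoC (x - c * t)) ->
     solves_kawahara_at kappa alpha beta
       (fun x' t' => wave_profile kappa alpha beta P (x' - c * t')) x t) /\
  (forall xi : R, ~ is_pole P (RtoC xi) ->
     solves_integrated_ode_at kappa alpha beta c A
       (wave_profile kappa alpha beta P) xi) /\
  A <> 0.
Proof.
  set (L := 35 / (3 * 13 ^ 2 * kappa * beta)).
  set (b := 2 ^ 2 * 3 * 13 * beta).
  split; [exact (weierstrass_real g2 g3 P hP)|split; [|split]].
  - intros x t hx.
    destruct (wave_chain g2 g3 L alpha b P (x - c * t) hP hx) as [q H].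
    set (F := fun k y => wave_derivative L alpha b g2 g3 k (Re (P (RtoC y))) (q y)).
    assert (Hx : locally x (fun y => forall k, (k < 5)%nat ->
      is_derive (fun u => F k (u - c * t)) y (F (S k) (y - c * t)))).
    { assert (hc : continuous (fun y => y - c * t) x).
      { apply ex_derive_continuous_R. auto_derive. exact I. }
      assert (hcH := hc _ H). unfold filtermap in hcH. revert hcH. apply filter_imp. intros y hy k hk.
      assert (h1 := is_derive_comp (F k) (fun u => u - c * t) y _ 1 (hy k hk)).
      rewrite <- (Rmult_1_l (F (S k) (y - c * t))).
      apply h1. auto_derive; [exact I|ring]. }
    assert (K := derivative_chain (fun k y => F k (y - c * t)) 5 x Hx).
    assert (ht : is_derive (fun s => F 0%nat (x - c * s)) t (- c * F 1%nat (x - c * t))).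
    { apply (is_derive_comp (F 0%nat) (fun s => x - c * s)).
      - apply (locally_singleton _ _ H). lia.
      - auto_derive; [exact I|ring]. }
    assert (Kx := locally_singleton _ _ K).
    split; [eexists; exact ht|split].
    + unfold differentiable_n. revert K. apply filter_imp. intros y hy k hk. exact (proj1 (hy k hk)).
    + assert (e0 := is_derive_unique _ _ _ ht).
      assert (e1 := proj2 (Kx 1%nat ltac:(lia))).
      assert (e3 := proj2 (Kx 3%nat ltac:(lia))).
      assert (e5 := proj2 (Kx 5%nat ltac:(lia))).
      (* The wave profile is [F 0] up to unfolding, and a first derivative is [Derive_n] of order
         1. *)
      change (Derive (fun s => F 0%nat (x - c * s)) t
        + kappa * F 0%nat (x - c * t) * Derive_n (fun y => F 0%nat (y - c * t)) 1 x
        + alpha * Derive_n (fun y => F 0%nat (y - c * t)) 3 x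
        - beta * Derive_n (fun y => F 0%nat (y - c * t)) 5 x = 0).
      rewrite e1, e3, e5.
      replace (Derive (fun s => F 0%nat (x - c * s)) t)
        with (- c * F 1%nat (x - c * t)) by (symmetry; exact e0).
      (* Every term contains one derivative of odd order, hence a factor [q]; the cofactor is a
         polynomial in [p] that vanishes identically for these [g2] and [g3]. *)
      unfold F, wave_derivative, L, b. rewrite hg2, hg3. field. lra.
  - intros xi hxi.
    destruct (wave_chain g2 g3 L alpha b P xi hP hxi) as [q H].
    set (F := fun k y => wave_derivative L alpha b g2 g3 k (Re (P (RtoC y))) (q y)).
    assert (K := derivative_chain F 5 xi H).
    assert (Kx := locally_singleton _ _ K).
    split.
    + unfold differentiable_n. revert K. apply filter_imp. intros y hy k hk. exact (proj1 (hy k ltac:(lia))).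
    + assert (e2 := proj2 (Kx 2%nat ltac:(lia))).
      assert (e4 := proj2 (Kx 4%nat ltac:(lia))).
      change (- c * F 0%nat xi + kappa / 2 * F 0%nat xi ^ 2
        + alpha * Derive_n (F 0%nat) 2 xi - beta * Derive_n (F 0%nat) 4 xi = A).
      rewrite e2, e4.
      (* Only even orders occur, so this is an identity in [p] alone. The values of [L] and [b]
         cancel the terms in [p ^ 4] and [p ^ 3], those of [g2] and [g3] cancel the terms in [p ^ 2]
         and [p], and the constant term is [A]. *)
      unfold F, wave_derivative, L, b. rewrite hg2, hg3, hA. field. lra.
  (* The two factors of the numerator vanish exactly at the two excluded speeds, [1836] being
     [2 ^ 2 * 3 ^ 3 * 17] and [845] being [5 * 169]. *)
  - rewrite hA. unfold Rdiv.
    repeat apply Rmult_integral_contrapositive_currified.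
    + intros h. apply hc1. apply (Rmult_eq_reg_r (169 * beta)); [|lra].
      field_simplify; lra.
    + intros h. apply hc2. apply (Rmult_eq_reg_r (845 * beta)); [|lra].
      field_simplify; lra.
    + apply Rinv_neq_0_compat.
      repeat apply Rmult_integral_contrapositive_currified; try apply pow_nonzero; lra.
Qed.
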